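(* $\kappa(v) = add(v^0)$.
   Context: $[\omega]^\omega$ is the family of all infinite subsets of $\omega$; $A \subseteq^* X$ means $A\setminus X$ is finite. For $A \subseteq B \subseteq \omega$ with $B\setminus A$ infinite, the set $\langle A,B\rangle = \{X \in [\omega]^\omega : A \subseteq X \subseteq B\}$ is called a segment, and $\langle A,B\rangle^* = \{X \in [\omega]^\omega: A \subseteq^* X \subseteq^* B\}$ is called a $*$-segment. Two $*$-segments are $*$-disjoint if their intersection is countable. A set $S \subseteq [\omega]^\omega$ is a $v^0$-set if for each segment $\langle A,B\rangle$ there is a segment $\langle C,D\rangle \subseteq \langle A,B\rangle$ with $\langle C,D\rangle \cap S = \emptyset$. The family of all $v^0$-sets is a $\sigma$-ideal, denoted $(v^0)$, and $add(v^0) = \min\{|\mathcal{F}| : \mathcal{F} \subseteq (v^0) \text{ and } \bigcup\mathcal{F} \notin (v^0)\}$. A $v$-partition is a family $\mathcal{P}$ of $*$-segments, any two distinct members of which are $*$-disjoint, and which is maximal (with respect to inclusion) among such families. A $v$-matrix is a collection of $v$-partitions. A $v$-matrix $\mathcal{H}$ is shattering if for each $*$-segment $\langle A,B\rangle^*$ there exist $\mathcal{P}\in\mathcal{H}$ and $\langle A_1,B_1\rangle^*, \langle A_2,B_2\rangle^* \in \mathcal{P}$ such that $\langle A_1,B_1\rangle^* \cap \langle A,B\rangle^*$ and $\langle A_2,B_2\rangle^* \cap \langle A,B\rangle^*$ are different $*$-segments. $\kappa(v)$ denotes the least cardinality of a shattering $v$-matrix. *)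

(* Defs.v *)
From mathcomp Require Import all_boot.
From mathcomp Require Import boolp classical_sets functions cardinality.

Set Implicit Arguments.
Unset Strict Implicit.
Unset Printing Implicit Defensive.

Local Open Scope classical_set_scope.
Local Open Scope card_scope.

(* Subsets of omega are terms of
   [set nat]; a family of infinite sets is a [set (set nat)]. *)

Definition infinite_subsets : set (set nat) := [set X | infinite_set X].

Definition almost_subset (A X : set nat) : Prop := finite_set (A `\` X).

Definition segment_bounds (A B : set nat) : Prop :=
  A `<=` B /\ infinite_set (B `\` A).

(* Only meaningful when [segment_bounds A B] holds. *)
Definition segment (A B : set nat) : set (set nat) :=
  [set X | [/\ infinite_subsets X, A `<=` X & X `<=` B]].

Definition star_segment (A B : set nat) : set (set nat) :=
  [set X | [/\ infinite_subsets X, almost_subset A X & almost_subset X B]].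

(* A *-segment is identified with the set <A,B>*; different bounds may give
   the same *-segment. *)
Definition is_star_segment (I : set (set nat)) : Prop :=
  exists A B, segment_bounds A B /\ I = star_segment A B.

Definition star_disjoint (I J : set (set nat)) : Prop := countable (I `&` J).

Definition v0 (S : set (set nat)) : Prop :=
  S `<=` infinite_subsets /\
  forall A B, segment_bounds A B ->
    exists C D, [/\ segment_bounds C D, segment C D `<=` segment A B
                  & segment C D `&` S = set0].

Definition star_disjoint_family (P : set (set (set nat))) : Prop :=
  P `<=` is_star_segment /\
  forall I J, P I -> P J -> I <> J -> star_disjoint I J.

Definition v_partition (P : set (set (set nat))) : Prop :=
  star_disjoint_family P /\
  forall Q, star_disjoint_family Q -> P `<=` Q -> Q = P.

Definition v_matrix (H : set (set (set (set nat)))) : Prop :=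
  H `<=` v_partition.

Definition shattering (H : set (set (set (set nat)))) : Prop :=
  forall I, is_star_segment I ->
    exists P, H P /\
      exists I1 I2, [/\ P I1, P I2, is_star_segment (I1 `&` I),
                        is_star_segment (I2 `&` I) & I1 `&` I <> I2 `&` I].

(* Cardinal numbers are represented by sets K : set U over arbitrary types,
   up to equipotence [#=].  [least_cardinality C K] says that the minimum of
   the cardinalities of the members of C exists and is the cardinality of K. *)
Definition least_cardinality (T : Type) (C : set (set T))
    (U : Type) (K : set U) : Prop :=
  (exists2 X, C X & X #= K) /\ (forall X, C X -> K #<= X).

Definition is_kappa_v (U : Type) (K : set U) : Prop :=
  least_cardinality [set H | v_matrix H /\ shattering H] K.

Definition is_add_v0 (U : Type) (K : set U) : Prop :=
  least_cardinality [set F | F `<=` v0 /\ ~ v0 (\bigcup_(S in F) S)] K.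

(* Main.v *)
Require Import Defs.
From mathcomp Require Import all_boot.
From mathcomp Require Import boolp classical_sets functions cardinality wochoice.

(* add(v0) <= kappa(v): for a v-partition P, a recursion of length continuum
   builds a v0-set S that meets every segment not covered by a single member
   of P, in particular every segment on which P shatters.  The recursion never
   gets stuck, because fewer than continuum many pairwise *-disjoint *-segments
   cover a segment only if one of them does (an almost disjointness argument).
   Applied to each member of a shattering v-matrix this gives a family of
   v0-sets whose union meets every segment.

   kappa(v) <= add(v0): by fusion, below every segment there is a *-segment
   missing a given v0-set S, so S is missed by all members of some v-partition.
   If the union of a family of v0-sets meets every segment inside <A0,B0>,
   transport <A0,B0> to the whole space; a *-segment on which none of the
   resulting v-partitions shatters lies inside one member of each of them, hence
   misses the whole union.

   Both minima are then attained at the least cardinality of a family witnessing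
   add(v0), which exists since cardinals are well ordered. *)

Set Implicit Arguments.
Unset Strict Implicit.
Unset Printing Implicit Defensive.

Local Open Scope classical_set_scope.
Local Open Scope card_scope.

(** * Calculus of inclusions modulo finite sets *)

Definition eventually (P : nat -> Prop) : Prop :=
  exists N, forall n, N <= n -> P n.

Lemma eventuallyW (P : nat -> Prop) : (forall n, P n) -> eventually P.
Proof. by move=> HP; exists 0. Qed.

Lemma eventually_mp (P Q : nat -> Prop) :
  eventually P -> eventually (fun n => P n -> Q n) -> eventually Q.
Proof.
move=> [N HN] [M HM]; exists (maxn N M) => n.
by rewrite geq_max => /andP[/HN Pn /HM]; apply.
Qed.

Lemma finite_eventually (A : set nat) :
  finite_set A <-> eventually (fun n => ~ A n).
Proof.
split=> [/finite_seqP[s ->]|[N HN]].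
  exists (\max_(x <- s) x).+1 => n ltn /= ns.
  by move: ltn; rewrite ltnNge => /negP; apply; exact: leq_bigmax_seq.
apply: (sub_finite_set _ (finite_II N)) => n An /=.
by rewrite ltnNge; apply/negP => /HN.
Qed.

Lemma almost_subsetE (A B : set nat) :
  almost_subset A B <-> eventually (fun n => A n -> B n).
Proof.
rewrite /almost_subset finite_eventually; split=> H; apply: (eventually_mp H);
  apply: eventuallyW => n /=; last by move=> AB [] /AB.
by move=> AB An; apply: contrapT => nB; apply: AB.
Qed.

Lemma asbool_True : `[< True >] = true. Proof. exact/asboolP. Qed.

Lemma asbool_False : `[< False >] = false. Proof. exact/asboolP. Qed.

(* Pointwise set inclusions by truth table: every membership becomes a boolean
   variable. *)
Ltac membership :=
  rewrite /setU /setI /setD /setC /setT /set0 /mkset /=;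
  apply/asboolP;
  rewrite !(asbool_imply, asbool_neg, asbool_and, asbool_or, asbool_True, asbool_False);
  repeat match goal with |- context [asbool ?P] => case: (asbool P) => //= end;
  done.

(* Inclusions modulo finite sets hold pointwise beyond a common bound. *)
Ltac almost :=
  repeat match goal with
  | H : almost_subset _ _ |- _ => move/almost_subsetE in H
  | H : finite_set _ |- _ => move/finite_eventually in H
  | H : _ `<=` _ |- _ => move/eventuallyW in H
  end;
  try apply/almost_subsetE; try apply/finite_eventually;
  repeat match goal with
  | H : eventually _ |- _ => apply: (eventually_mp H); clear H
  end;
  apply: eventuallyW => ?; membership.

Lemma infinite_almost_subset (A B : set nat) :
  infinite_set A -> almost_subset A B -> infinite_set B.
Proof. by move=> Ainf AB Bfin; apply: Ainf; almost. Qed.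

Lemma finite_almost_subset (A B : set nat) :
  finite_set B -> almost_subset A B -> finite_set A.
Proof. by move=> Bfin AB; almost. Qed.

Lemma almost_subset_refl (A : set nat) : almost_subset A A.
Proof. by almost. Qed.

Lemma almost_subset_trans (A B C : set nat) :
  almost_subset A B -> almost_subset B C -> almost_subset A C.
Proof. by move=> AB BC; almost. Qed.

(** * Families smaller than the continuum *)

(** Encodes that [U] has fewer than continuum many elements: no map takes [U] onto the binary
    sequences. Diagonal arguments can use this form directly. *)
Definition below_continuum (W : Type) (U : set W) : Prop :=
  forall f : W -> nat -> bool, exists t, forall w, U w -> f w <> t.

Lemma below_continuum_nat : below_continuum [set: nat].
Proof.
by move=> f; exists (fun n => ~~ f n n) => n _ /(congr1 (@^~ n)) /=; case: (f n n).
Qed.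

(** Bit 0 is reserved for differing from [f v], while the tail avoids the tails of all [f w] with
    [w] in [U]. *)
Lemma below_continuum_setU1 (W : Type) (U : set W) (v : W) :
  below_continuum U -> below_continuum (U `|` [set v]).
Proof.
move=> HU f; have [t Ht] := HU (fun w n => f w n.+1).
exists (fun n => if n is m.+1 then t m else ~~ f v 0) => w [Uw fw|-> /(congr1 (@^~ 0))].
  by apply: (Ht w Uw); rewrite fw.
by case: (f v 0).
Qed.

(** Each [w] in [U] excludes at most one [t], so a single map on [U] lists all excluded
    sequences. *)
Lemma below_continuum_avoid (W : Type) (U : set W) (K : W -> (nat -> bool) -> Prop) :
  below_continuum U -> (forall w t t', U w -> K w t -> K w t' -> t = t') ->
  exists t, forall w, U w -> ~ K w t.
Proof.
move=> HU Kfun; have [t Ht] := HU (fun w => xget (fun=> true) (K w)).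
exists t => w Uw Kwt; apply: (Ht w Uw).
by apply: (Kfun w) => //; apply: xgetI Kwt.
Qed.

Lemma infinite_enum (E : set nat) : infinite_set E ->
  exists e : nat -> nat, injective e /\ forall n, E (e n).
Proof.
move=> /infiniteP/pcard_leP[f]; exists f; split.
  by move=> m n; apply: inj; rewrite inE.
by move=> n; have /= := @funS _ _ _ _ f n I.
Qed.

Lemma infinite_range (e : nat -> nat) (Z : set nat) :
  injective e -> infinite_set Z -> infinite_set (e @` Z).
Proof.
move=> einj Zinf efin; apply: Zinf; apply: (@sub_finite_set _ _ (e @^-1` (e @` Z))).
  by move=> n Zn; exists n.
by apply: finite_preimage efin => m n _ _; exact: einj.
Qed.

(** Branches of the binary tree, with its nodes coded injectively in [E]: distinct branches share
    only finitely many nodes. *)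
Lemma almost_disjoint_family (E : set nat) : infinite_set E ->
  exists Z : (nat -> bool) -> set nat,
    [/\ forall t, Z t `<=` E, forall t, infinite_set (Z t)
      & forall (Y : set nat) t t', infinite_set Y ->
          almost_subset Y (Z t) -> almost_subset Y (Z t') -> t = t'].
Proof.
move=> /infinite_enum[e [einj eE]].
pose b (t : nat -> bool) n := e (pickle (mkseq t n)).
have binj t t' m n : b t m = b t' n -> m = n /\ mkseq t m = mkseq t' n.
  move=> /einj/(pcan_inj pickleK) tt'; split => //.
  by rewrite -(size_mkseq t m) tt' size_mkseq.
exists (fun t => [set b t n | n in setT]); split.
- by move=> t _ [n _ <-]; exact: eE.
- move=> t; apply: infinite_range; last exact: infinite_nat.
  by move=> m n /binj[].
move=> Y t t' Yinf Yt Yt'; apply: contrapT => tt'; apply: Yinf.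
have [m tm] : exists m, t m <> t' m.
  by apply/not_existsP => H; apply: tt'; apply/funext => m; apply: contrapT => /H.
(* A common prefix of length greater than [m] would contain the bit where [t] and [t'] differ. *)
apply: (finite_almost_subset (B := b t @` `I_m.+1)); first exact: finite_image.
suff sub : b t @` setT `&` b t' @` setT `<=` b t @` `I_m.+1.
  by move: sub Yt Yt'; move: (_ @` _) (_ @` _) (_ @` _) => A B C *; almost.
move=> _ [[n _ <-] [n' _ /esym/binj[<- eqn]]]; exists n => //=.
rewrite ltnS leqNgt; apply/negP => mn; apply: tm.
by have := congr1 (nth true ^~ m) eqn; rewrite !nth_mkseq.
Qed.

Lemma infinite_split (E : set nat) : infinite_set E ->
  exists E0 E1, [/\ E0 `<=` E, E1 `<=` E, E0 `&` E1 = set0, infinite_set E0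
                  & infinite_set E1].
Proof.
move=> /almost_disjoint_family[Z [ZE Zinf Zad]].
pose t (n : nat) := true; pose t' (n : nat) := false.
exists (Z t), (Z t' `\` Z t); split => //.
- by move=> n [/ZE].
- by apply/seteqP; split=> n // [] ? [].
move=> fin; suff /(congr1 (@^~ 0)) : t = t' by [].
apply: (Zad (Z t')) => //; exact: almost_subset_refl.
Qed.

(** * *-segments *)

(** The version of [segment_bounds] that is stable under finite changes of [A] and [B]. It holds
    exactly when [star_segment A B] is uncountable. *)
Definition wide (A B : set nat) : Prop :=
  almost_subset A B /\ infinite_set (B `\` A).

Lemma segment_bounds_wide (A B : set nat) : segment_bounds A B -> wide A B.
Proof. by move=> [AB inf]; split=> //; almost. Qed.

Lemma star_segmentI (A B C D : set nat) :
  star_segment A B `&` star_segment C D = star_segment (A `|` C) (B `&` D).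
Proof.
apply/seteqP; split=> X.
  by move=> [[Xinf AX XB] [_ CX XD]]; split=> //; [clear XB XD|clear AX CX]; almost.
by move=> [Xinf AX XB]; split; split=> //; almost.
Qed.

Lemma star_segmentS (A B C D : set nat) :
  almost_subset C A -> almost_subset B D -> star_segment A B `<=` star_segment C D.
Proof.
move=> CA BD X [Xinf AX XB]; split=> //.
  exact: almost_subset_trans AX.
exact: almost_subset_trans BD.
Qed.

Lemma segment_star (A B : set nat) : segment A B `<=` star_segment A B.
Proof. by move=> X [Xinf AX XB]; split=> //; almost. Qed.

Lemma wide_is_star_segment (A B : set nat) :
  wide A B -> is_star_segment (star_segment A B).
Proof.
move=> [AB inf]; exists (A `&` B), B; split.
  split; first by move=> n [].
  by apply: (infinite_almost_subset inf); almost.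
by apply/seteqP; split; apply: star_segmentS; almost.
Qed.

(** If there is a member at all, [B \ A] is finite, so every member differs from [A] by a finite
    set; [toggle] is the symmetric difference with [A]. *)
Lemma countable_star_segment (A B : set nat) :
  ~ wide A B -> countable (star_segment A B).
Proof.
move=> nw; have [->|/set0P[X0 [_ AX0 X0B]]] := eqVneq (star_segment A B) set0; first by [].
have fin : finite_set (B `\` A).
  by apply: contrapT => inf; apply: nw; split=> //; exact: almost_subset_trans X0B.
pose toggle (Y : set nat) : set nat := (Y `\` A) `|` (A `\` Y).
have sub : star_segment A B `<=`
    toggle @` [set Y | Y `<=` setT /\ finite_set Y].
  move=> X [_ AX XB]; exists (toggle X).
    by split=> //; rewrite /toggle; almost.
  by apply/seteqP; split=> n; rewrite /toggle; membership.
apply: (sub_countable (card_le_trans (subset_card_le sub) (card_image_le _ _))).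
exact/countable_finite_subset/countableP.
Qed.

(** Adjoining to [A] the members of an almost disjoint family inside [B \ A] gives continuum many
    distinct elements. *)
Lemma uncountable_star_segment (A B : set nat) :
  wide A B -> ~ countable (star_segment A B).
Proof.
move=> [AB inf] /countable_injP[g ginj].
have [Z [ZE Zinf Zad]] := almost_disjoint_family inf.
have inS t : star_segment A B (A `|` Z t).
  have ZEt := ZE t; split; try by move: (Z t) ZEt => Y *; almost.
  by apply: (infinite_almost_subset (Zinf t)); move: (Z t) => Y; almost.
have [||t Ht] := @below_continuum_avoid nat setT (fun n t => g (A `|` Z t) = n).
- exact: below_continuum_nat.
- move=> n t t' _ <- /esym/ginj; rewrite !inE => /(_ (inS t) (inS t')) eqZ.
  apply: (Zad (Z t)) => //; first exact: almost_subset_refl.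
  move: eqZ (ZE t) (ZE t'); move: (Z t) (Z t') => Y Y' + YE YE'.
  move=> /seteqP[eq1 _]; almost.
exact: (Ht (g (A `|` Z t))).
Qed.

Lemma star_disjoint_wide (A B C D : set nat) :
  star_disjoint (star_segment A B) (star_segment C D) <->
  ~ wide (A `|` C) (B `&` D).
Proof.
rewrite /star_disjoint star_segmentI; split; last exact: countable_star_segment.
by move=> cnt /uncountable_star_segment.
Qed.

(** An infinite [F w] is almost contained in at most one member of an almost disjoint family. *)
Lemma below_continuum_almost_avoid (W : Type) (U : set W) (F : W -> set nat)
    (E : set nat) : below_continuum U -> infinite_set E ->
  exists Z, [/\ Z `<=` E, infinite_set Z
    & forall w, U w -> infinite_set (F w) -> ~ almost_subset (F w) Z].
Proof.
move=> HU /almost_disjoint_family[Z [ZE Zinf Zad]].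
pose K w t := infinite_set (F w) /\ almost_subset (F w) (Z t).
have [|t Ht] := below_continuum_avoid (K := K) HU.
  by move=> w t t' _ [inf Ft] [_ Ft']; exact: Zad Ft'.
by exists (Z t); split=> // w Uw inf FZ; apply: (Ht w Uw).
Qed.

(* If some [star_segment (A v) (B v)] meets [star_segment C D], it misses part of
   it because one coordinate set E, disjoint from the free coordinates
   M = (D & B v) \ (C | A v), is frozen by it.  A *-segment
   *-disjoint from it that contains X either disagrees with it infinitely often
   on E, hence determines the trace of X on E among almost disjoint candidates,
   or freezes almost all of M, hence determines the trace of X on M. *)
Lemma uncovered_point (W : Type) (U : set W) (A B : W -> set nat) (C D : set nat) :
  below_continuum U -> segment_bounds C D ->
  (forall v w, U v -> U w -> v <> w -> ~ wide (A v `|` A w) (B v `&` B w)) ->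
  (forall w, U w -> ~ star_segment C D `<=` star_segment (A w) (B w)) ->
  exists X, segment C D X /\ forall w, U w -> ~ star_segment (A w) (B w) X.
Proof.
move=> HU [CD CDinf] disj nsub.
have [[v Uv [v1 v2]]|nomeet] := pselect (exists2 v, U v & wide (C `|` A v) (D `&` B v)); last first.
  (* A *-segment containing [C | Y] but not meeting [<C,D>*] in a *-segment would have
     [A w & (D \ C)] almost equal to [Y]. *)
  have [Y [YE Yinf Yav]] := below_continuum_almost_avoid (fun w => A w `&` (D `\` C)) HU CDinf.
  exists (C `|` Y); split.
    split; [|by move=> n; left|by move=> n [/CD|/YE[]]].
    by apply: (infinite_almost_subset Yinf); almost.
  move=> w Uw [_ AX XB]; have nw : ~ wide (C `|` A w) (D `&` B w) by move=> ?; apply: nomeet; exists w.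
  have fin : finite_set ((D `&` B w) `\` (C `|` A w)).
    apply: contrapT => inf; apply: nw; split=> //.
    by clear nsub; almost.
  apply: (Yav w Uw); last by almost.
  by apply: (infinite_almost_subset Yinf); almost.
have [Y [YM Yinf Yav]] :=
  below_continuum_almost_avoid (fun w => (A v `|` A w) `&` ((D `&` B v) `\` (C `|` A v))) HU v2.
have [fin1|Einf] := pselect (finite_set (D `\` B v `\` C)); last first.
  have [Z [ZE Zinf Zav]] := below_continuum_almost_avoid (fun w => A w `\` B v) HU Einf.
  (* [Z] is infinite and outside [B v], which keeps [X] out of the *-segment of [v]; [Y] is the
     trace of [X] on the free part M. *)
  pose X := C `|` (A v `&` D) `|` Z `|` Y.
  exists X; split.
    split; [|by move=> n; do 3 left|by move=> n [[[/CD|[]]|/ZE[[]]]|/YM[[]]]].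
    by apply: (infinite_almost_subset Yinf); rewrite /X; almost.
  move=> w Uw [_ AX XB].
  have [wv|wv] := pselect (v = w).
    subst w; apply: Zinf; rewrite /X in XB; by almost.
  have H := Zav w Uw.
  have fin2 : finite_set (A w `\` B v).
    by apply: contrapT => /H; apply; rewrite /X in AX; almost.
  (* The lower bounds of [v] and [w] are now almost below both upper bounds, so *-disjointness makes
     the common free part finite and [Y] lies almost inside [A w]. *)
  have fin3 : finite_set ((B v `&` B w) `\` (A v `|` A w)).
    apply: contrapT => inf; apply: (disj v w) => //; split=> //.
    by rewrite /X in AX XB; almost.
  apply: (Yav w Uw); last by rewrite /X in AX XB; almost.
  by apply: (infinite_almost_subset Yinf); rewrite /X in AX XB; almost.
(* Dual case: [D] is almost inside [B v], so the inclusion fails at the lower bound, and [Z] is now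
   removed from [X] instead of added. *)
have Einf : infinite_set ((A v `&` D) `\` C).
  by move=> fin2; apply: (nsub v Uv); apply: star_segmentS; almost.
have [Z [ZE Zinf Zav]] := below_continuum_almost_avoid (fun w => A v `\` B w) HU Einf.
pose X := C `|` ((A v `&` D) `\` C `\` Z) `|` Y.
exists X; split.
  split; [|by move=> n; do 2 left|by move=> n [[/CD|[[[]]]]|/YM[[]]]].
  by apply: (infinite_almost_subset Yinf); rewrite /X; almost.
move=> w Uw [_ AX XB].
have [wv|wv] := pselect (v = w).
  by subst w; apply: Zinf; rewrite /X in AX; almost.
have H := Zav w Uw.
have fin2 : finite_set (A v `\` B w).
  by apply: contrapT => /H; apply; rewrite /X in XB; almost.
have fin3 : finite_set ((B v `&` B w) `\` (A v `|` A w)).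
  apply: contrapT => inf; apply: (disj v w) => //; split=> //.
  by rewrite /X in AX XB; almost.
apply: (Yav w Uw); last by rewrite /X in AX XB; almost.
by apply: (infinite_almost_subset Yinf); rewrite /X in AX XB; almost.
Qed.

(** * A v0-set transversal to a v-partition *)

(** Choice along a well-founded relation. The value at [a] is picked from the history below [a],
    padded with [b0]; since [Phi] only looks below [a], the padded history can be exchanged for
    [h]. *)
Lemma wf_choice (W B : Type) (lt : W -> W -> Prop) (b0 : B)
    (Phi : W -> (W -> B) -> B -> Prop) :
  well_founded lt ->
  (forall a h h' b, (forall w, lt w a -> h w = h' w) -> Phi a h b -> Phi a h' b) ->
  (forall a h, (forall w, lt w a -> Phi w h (h w)) -> exists b, Phi a h b) ->
  exists h, forall a, Phi a h (h a).
Proof.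
move=> wf Phi_ext step.
have /choice[pick pickP] : forall Q : B -> Prop, exists y, (exists b, Q b) -> Q y.
  by move=> Q; have [[b Qb]|nQ] := pselect (exists b, Q b); [exists b|exists b0].
pose ext a (rec : forall w, lt w a -> B) w :=
  if pselect (lt w a) is left p then rec w p else b0.
pose F a (rec : forall w, lt w a -> B) : B := pick (Phi a (ext a rec)).
pose h := Fix wf (fun=> B) F.
have hE a : h a = pick (Phi a (ext a (fun w _ => h w))).
  rewrite {1}/h Fix_eq // => x f g fg; rewrite /F; congr (pick (Phi _ (ext _ _))).
  by apply: functional_extensionality_dep => w; apply: functional_extensionality_dep.
have extE a w : lt w a -> h w = ext a (fun w _ => h w) w.
  by move=> wa; rewrite /ext; case: pselect.
exists h; apply: (well_founded_ind wf) => a IH.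
have [b Phib] := step a h IH.
apply: (Phi_ext a (ext a (fun w _ => h w))) => [w /extE //|].
by rewrite hE; apply: pickP; exists b; exact: Phi_ext (extE a) Phib.
Qed.

(** Well-order the binary sequences and cut at the least [a] whose predecessors already map onto all
    sequences; without such an [a] the whole order serves. *)
Lemma continuum_well_order :
  exists (W : Type) (lt : W -> W -> Prop) (f : W -> nat -> bool),
    [/\ well_founded lt, forall v w, v <> w -> lt v w \/ lt w v,
        forall a, below_continuum [set w | lt w a] & forall t, exists w, f w = t].
Proof.
have [R Rwo] := well_ordering_principle (nat -> bool).
have Rch : wo_chain R predT by move=> A _; exact: Rwo.
have Rtot x y : R x y \/ R y x.
  by apply/orP; exact: (wo_chainW Rch).
have Ranti x y : R x y -> R y x -> x = y.
  by move=> xy yx; apply: (wo_chain_antisymmetric Rch) => //; rewrite xy.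
pose lt x y := ~~ R y x.
have minimal (A : set (nat -> bool)) : A !=set0 -> exists2 z, A z & forall y, lt y z -> ~ A y.
  move=> [x Ax]; have [|z [[/asboolP Az zmin] _]] := Rwo [pred y | `[< A y >] ].
    by exists x; exact/asboolP.
  exists z => // y /negP yz Ay; apply: yz; apply: zmin; exact/asboolP.
have wf : well_founded lt.
  move=> x; apply: contrapT => nx; have [|z nz zmin] := minimal [set x | ~ Acc lt x].
    by exists x.
  by apply: nz; constructor => y /zmin/contrapT.
have lt_total v w : v <> w -> lt v w \/ lt w v.
  move=> vw; apply/orP; rewrite -negb_and; apply/negP => /andP[wv vw'].
  exact/vw/Ranti.
suff [D [[f fsurj] Dbelow]] : exists D : set (nat -> bool),
    (exists f : (nat -> bool) -> nat -> bool, forall t, exists2 w, D w & f w = t) /\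
    forall a, D a -> below_continuum [set w | D w /\ lt w a].
  exists {w | D w}, (fun v w => lt (sval v) (sval w)), (fun w => f (sval w)); split.
  - move=> [x Dx]; elim: (wf x) Dx => {}x _ IH Dx.
    by constructor => -[y Dy] /= yx; exact: IH.
  - by move=> [v Dv] [w Dw] vw; apply: lt_total => /= eqvw; apply/vw/eq_exist.
  - move=> [a Da] g /=.
    have [t Ht] := Dbelow a Da (fun w => if pselect (D w) is left p then g (exist _ w p) else xpred0).
    exists t => -[w Dw] /= wa; have := Ht w (conj Dw wa); case: pselect => // Dw'.
    by rewrite (Prop_irrelevance Dw Dw').
  - by move=> t; have [w Dw fw] := fsurj t; exists (exist _ w Dw).
have [[a0 na0]|allb] := pselect (exists a, ~ below_continuum [set w | lt w a]).
  have [|a /existsNP[f fsurj] amin] := minimal [set a | ~ below_continuum [set w | lt w a]].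
    by exists a0.
  exists [set w | lt w a]; split.
    exists f => t; apply: contrapT => nt; apply: fsurj; exists t => w wa fw.
    by apply: nt; exists w.
  move=> b /amin/contrapT bb g; have [t Ht] := bb g.
  by exists t => w [_]; exact: Ht.
exists setT; split; first by exists id => t; exists t.
move=> a _; have: below_continuum [set w | lt w a].
  by apply: contrapT => na; apply: allb; exists a.
by move=> bb g; have [t Ht] := bb g; exists t => w [_]; exact: Ht.
Qed.

(** Otherwise maximality would put [star_segment A B] into [P], and it would be *-disjoint from
    itself although uncountable. *)
Lemma v_partition_meets (P : set (set (set nat))) (A B : set nat) :
  v_partition P -> wide A B ->
  exists A1 B1, P (star_segment A1 B1) /\ wide (A `|` A1) (B `&` B1).
Proof.
move=> [[Pseg Pdisj] Pmax] AB; apply: contrapT => nomeet.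
have disj I : P I -> star_disjoint (star_segment A B) I.
  move=> PI; have [A1 [B1 [_ IE]]] := Pseg _ PI; subst I.
  by apply/star_disjoint_wide => w; apply: nomeet; exists A1, B1.
have PAB : P (star_segment A B).
  rewrite -(Pmax (P `|` [set star_segment A B])); first by right.
    split; first by move=> I [/Pseg|->] //; exact: wide_is_star_segment.
    move=> I J [PI|->] [PJ|->] IJ //; [exact: Pdisj|rewrite /star_disjoint setIC|];
      exact: disj.
  by move=> I; left.
apply: (uncountable_star_segment AB).
by have := disj _ PAB; rewrite /star_disjoint setIid.
Qed.

Lemma shrink_into_star_segment (A B C D : set nat) :
  segment_bounds A B -> wide (A `|` C) (B `&` D) ->
  exists A' B', [/\ segment_bounds A' B', A `<=` A', B' `<=` B
                  & star_segment A' B' `<=` star_segment C D].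
Proof.
move=> [AB _] [sub inf]; exists (A `|` (C `&` B)), (A `|` (C `&` B) `|` (B `&` D)).
split.
- split; first by move=> n; left.
  by apply: (infinite_almost_subset inf); almost.
- by move=> n; left.
- by move=> n [[/AB|[]]|[]].
- by apply: star_segmentS; clear inf; almost.
Qed.

Lemma segmentS (A B C D : set nat) :
  C `<=` A -> B `<=` D -> segment A B `<=` segment C D.
Proof.
by move=> CA BD X [Xinf AX XB]; split=> //; [exact: subset_trans AX|exact: subset_trans BD].
Qed.

Lemma segment_bounds_full : segment_bounds set0 setT.
Proof. by split; rewrite ?setD0 //; exact: infinite_nat. Qed.

Lemma star_segment_setT_set0 : star_segment setT set0 = set0.
Proof.
apply/seteqP; split=> // X [Xinf _ X0]; apply: Xinf.
by almost.
Qed.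

(* A Bernstein-type recursion of length continuum: the point handled at a stage
   avoids the *-segments chosen so far, and the *-segment chosen at a stage
   avoids the points chosen so far and is *-disjoint from earlier ones. *)
Lemma v_partition_transversal (P : set (set (set nat))) : v_partition P ->
  exists S, v0 S /\ forall C D, segment_bounds C D ->
    (forall I, P I -> ~ star_segment C D `<=` I) -> S `&` segment C D !=set0.
Proof.
move=> vP; have [W [lt [f [wf tot below fsurj]]]] := continuum_well_order.
have lt_irr w : ~ lt w w by elim: (wf w) => x _ IH xx; exact: (IH x xx xx).
(* The even and odd bits of [f w] code a pair of bounds, so every segment is the task of some
   stage. *)
pose lo w : set nat := [set n | f w n.*2]; pose hi w : set nat := [set n | f w n.*2.+1].
have task C D : exists w, lo w = C /\ hi w = D.
  have [w fw] := fsurj (fun n => if odd n then `[< D n./2 >] else `[< C n./2 >]).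
  exists w; rewrite /lo /hi fw; split; apply/seteqP; split=> n /=;
    rewrite ?uphalf_double ?odd_double ?doubleK /=; by move/asboolP.
pose stage := (set nat * (set nat * set nat))%type.
pose pt (s : stage) := s.1; pose A (s : stage) := s.2.1; pose B (s : stage) := s.2.2.
pose star s := star_segment (A s) (B s).
pose meets a s := wide (lo a `|` A s) (hi a `&` B s).
(* The first block concerns the new point, the second the new *-segment, and the last says that the
   task is met by some *-segment chosen so far. *)
pose Phi a (h : W -> stage) s := [/\
  [/\ segment_bounds (lo a) (hi a) ->
       (forall I, P I -> ~ star_segment (lo a) (hi a) `<=` I) ->
       segment (lo a) (hi a) (pt s)
    & forall w, lt w a -> ~ star (h w) (pt s)],
  [/\ exists2 I, P I & star s `<=` I,
      forall w, lt w a -> ~ wide (A s `|` A (h w)) (B s `&` B (h w)),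
      forall w, lt w a -> ~ star s (pt (h w)) & ~ star s (pt s)]
  & segment_bounds (lo a) (hi a) ->
      meets a s \/ exists2 w, lt w a & meets a (h w)].
have [||h Hh] := @wf_choice W stage lt (set0, (set0, set0)) Phi wf.
- move=> a h h' s hh' [[p1 p2] [q1 q2 q3 q4] r]; split; first split=> //.
  + by move=> w wa; rewrite -hh' //; exact: p2.
  + by split=> // w wa; rewrite -hh' //; [exact: q2|exact: q3].
  + by move=> /r[|[w wa mw]]; [left|right; exists w; rewrite -?hh'].
- move=> a h IH.
  have [X [X1 X2]] : exists X, 
     (segment_bounds (lo a) (hi a) ->
       (forall I, P I -> ~ star_segment (lo a) (hi a) `<=` I) ->
       segment (lo a) (hi a) X) /\ forall w, lt w a -> ~ star (h w) X.
    have [[bd nsub]|nbd] := pselect (segment_bounds (lo a) (hi a) /\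
        forall I, P I -> ~ star_segment (lo a) (hi a) `<=` I); last first.
      (* The dummy point is finite, hence in no *-segment. *)
      exists set0; split; first by move=> bd nsub; case: nbd.
      by move=> w _ [inf0 _ _]; apply: inf0; exact: finite_set0.
    have [||X [X1 X2]] := uncovered_point (A := A \o h) (B := B \o h) (below a) bd.
    + move=> v w va wa /tot[vw|wv]; last by have [_ [_ H _ _] _] := IH v va; exact: H.
      by have [_ [_ H _ _] _] := IH w wa; rewrite setUC setIC; exact: H.
    + move=> w wa sub; have [_ [[I PI sI] _ _ _] _] := IH w wa.
      by apply: (nsub I PI); exact: subset_trans sI.
    by exists X.
  have [[bd nmeet]|idle] := pselect (segment_bounds (lo a) (hi a) /\
      forall w, lt w a -> ~ meets a (h w)); last first.
    have [A0 [B0 [PI0 _]]] := v_partition_meets vP (segment_bounds_wide segment_bounds_full).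
    (* The dummy bounds give an empty *-segment. *)
    exists (X, (setT, set0)); split; first by [].
      rewrite /star /A /B /= star_segment_setT_set0; split; [|move=> w _|by move=> ? _ []|by case].
        by exists (star_segment A0 B0).
      by move=> [_]; rewrite set0I set0D; apply; exact: finite_set0.
    move=> bd; right; apply: contrapT => nm; apply: idle; split=> // w wa m.
    by apply: nm; exists w.
  have [A1 [B1 [PI [sub inf]]]] := v_partition_meets vP (segment_bounds_wide bd).
  (* [M0] is spent on avoiding the points chosen so far, including the current [X]; [M1] stays free.
     Members of the new *-segment have trace almost [Z] on [M0], which no avoided point has. *)
  have [M0 [M1 [M0E M1E M01 M0inf M1inf]]] := infinite_split inf.
  have {}M01 : M0 `&` M1 `<=` set0 by rewrite M01.
  pose g w := (if pselect (lt w a) then pt (h w) else X) `&` M0.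
  have [Z [ZE Zinf Zav]] := below_continuum_almost_avoid g
    (below_continuum_setU1 a (below a)) M0inf.
  pose A' := lo a `|` A1 `|` Z; pose B' := A' `|` M1.
  have avoid Y w : ([set w | lt w a] `|` [set a]) w -> g w = Y `&` M0 ->
      ~ star_segment A' B' Y.
    move=> Uw gw [_ AY YB]; have := Zav w Uw; rewrite gw; apply.
      by apply: (infinite_almost_subset Zinf); rewrite /A' in AY; almost.
    have: almost_subset (Y `&` M0) Z.
      by rewrite /B' /A' in YB; clear - YB M01 M0E; almost.
    by [].
  have out1 : ~ star (X, (A', B')) X.
    by apply: (avoid X a); [right|rewrite /g; case: pselect => // aa; case: (lt_irr a)].
  exists (X, (A', B')); split=> //; last first.
    move=> _; left; rewrite /meets /A /B /=; split.
      by rewrite /A' /B' /A'; clear inf; almost.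
    by apply: (infinite_almost_subset M1inf); rewrite /A' /B'; clear inf; almost.
  split=> //.
  + exists (star_segment A1 B1) => //.
    by apply: star_segmentS; rewrite /A /B /= /B' /A'; clear inf; almost.
  + move=> w wa /=; rewrite /A /B /= => -[q1 q2]; apply: (nmeet w wa).
    rewrite /meets /A /B; split.
      by move: (h w).2.1 (h w).2.2 q1 q2 => Aw Bw; rewrite /B' /A' => q1 _; clear inf; almost.
    apply: (infinite_almost_subset q2).
    by move: (h w).2.1 (h w).2.2 q1 q2 => Aw Bw; rewrite /B' /A' => q1 _; clear inf; almost.
  + move=> w wa; apply: (avoid (pt (h w)) w); first by left.
    by rewrite /g; case: pselect.
(* Restricting to infinite sets discards dummy points. *)
exists [set X | infinite_subsets X /\ exists w, pt (h w) = X]; split; last first.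
  move=> C D bd nsub; have [w [wC wD]] := task C D; subst C D.
  have [[p _] _ _] := Hh w; exists (pt (h w)); split; last exact: p.
  by split; [have [] := p bd nsub|exists w].
split; first by move=> X [].
move=> C D bd; have [a [aC aD]] := task C D; subst C D.
have [w mw] : exists w, meets a (h w).
  by have [_ _ /(_ bd)[m|[w _ m]]] := Hh a; [exists a|exists w].
have [C [D [bd' CA DB sub]]] := shrink_into_star_segment bd mw.
exists C, D; split=> //; first exact: segmentS.
apply/seteqP; split=> // X [/segment_star/sub Xs [_ [v vX]]]; subst X.
have [wv|wv] := pselect (w = v).
  by subst v; have [_ [_ _ _]] := Hh w.
case: (tot _ _ wv) => [wv'|vw].
  by have [[_ /(_ _ wv')]] := Hh v.
by have [_ [_ _ /(_ _ vw)]] := Hh w.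
Qed.

(** * v-partitions avoiding a v0-set *)

(** [C] may be finite and so not a member; it is recovered as the intersection of two members,
    [C | E0] and [C | E1]. The upper bound [D] is itself a member. *)
Lemma segment_subset (A B C D : set nat) :
  segment_bounds C D -> segment C D `<=` segment A B -> A `<=` C /\ D `<=` B.
Proof.
move=> [CD inf] sub.
have [E0 [E1 [E0E E1E E01 E0inf E1inf]]] := infinite_split inf.
have inCD E : E `<=` D `\` C -> infinite_set E -> segment C D (C `|` E).
  move=> EE Einf; split; [|by move=> n; left|by move=> n [/CD|/EE[]]].
  by apply: (infinite_almost_subset Einf); almost.
have [_ A0 _] := sub _ (inCD _ E0E E0inf); have [_ A1 _] := sub _ (inCD _ E1E E1inf).
split=> n; last first.
  have [] := sub D; last by move=> _ _; apply.
  by split=> //; apply: (infinite_almost_subset inf); almost.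
move=> An; have [//|E0n] := A0 n An; have [//|E1n] := A1 n An.
by have : (E0 `&` E1) n by []; rewrite E01.
Qed.

(** For each [s] in turn, the trace on [J] is replaced by that of [s], the result is shrunk to miss
    [S], and the old trace on [J] is restored. Later shrinking preserves earlier avoidance. *)
Lemma v0_avoid_patches (S : set (set nat)) (J : set nat) (L : seq (set nat)) (A B : set nat) :
  v0 S -> finite_set J -> segment_bounds A B ->
  exists A' B', [/\ segment_bounds A' B', A `<=` A' /\ B' `<=` B,
    A' `&` J `<=` A /\ B `&` J `<=` B'
    & forall s, s \in L -> forall X,
        segment ((s `&` J) `|` (A' `\` J)) ((s `&` J) `|` (B' `\` J)) X -> ~ S X].
Proof.
move=> [_ vS] Jfin AB; elim: L => [|s L [A1 [B1 [[AB1 inf1] [AA1 B1B] [A1J BJ] HL]]]].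
  by exists A, B; split=> //; split=> // n [].
have [|C [D [[CD infCD] /(segment_subset (conj CD infCD))[AC DB] CDS]]] :=
    vS ((s `&` J) `|` (A1 `\` J)) ((s `&` J) `|` (B1 `\` J)).
  split; first by move=> n; move: (AB1 n); membership.
  by apply: (infinite_almost_subset inf1); clear - Jfin; almost.
exists ((A1 `&` J) `|` (C `\` J)), ((B1 `&` J) `|` (D `\` J)); split.
- split; first by move=> n; move: (AB1 n) (CD n); membership.
  by apply: (infinite_almost_subset infCD); clear - Jfin; almost.
- split=> n; first by move: (AA1 n) (AC n); membership.
  by move: (B1B n) (DB n); membership.
- split=> n; first by move: (A1J n); membership.
  by move: (BJ n); membership.
move=> s' + X; rewrite in_cons => /orP[/eqP->|s'L] [Xinf AX XB] SX.
  suff: (segment C D `&` S) X by rewrite CDS.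
  split=> //; split=> // n.
    by move: (AX n) (CD n) (DB n); membership.
  by move: (XB n) (AC n) (CD n); membership.
apply: (HL s' s'L X) => //; split=> // n.
  by move: (AX n) (AC n); membership.
by move: (XB n) (DB n); membership.
Qed.

Lemma subsets_seq (n : nat) :
  exists L : seq (set nat), forall s, s `<=` `I_n -> s \in L.
Proof.
elim: n => [|n [L HL]].
  exists [:: set0] => s sub; rewrite inE; apply/eqP/seteqP; split=> // k /sub //.
exists (L ++ [seq s `|` [set n] | s <- L]) => s sub; rewrite mem_cat.
have sub' : s `\` [set n] `<=` `I_n.
  by move=> k [/sub /= kn /= /eqP nk]; rewrite ltn_neqAle nk -ltnS.
have [sn|nsn] := pselect (s n); apply/orP; [right|left].
  apply/mapP; exists (s `\` [set n]); first exact: HL.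
  by apply/seteqP; split=> k; [have [->|] := eqVneq k n; [right|move=> /eqP ? ?; left]|
    move=> [[]//|->]].
by apply: HL => k sk; apply: sub'; split=> // kn; apply: nsn; rewrite -kn.
Qed.

(* Fusion: stage j decides the segment for every finite pattern below n_j and
   then freezes one more free coordinate, so that infinitely many survive. *)
Lemma v0_star_avoid (S : set (set nat)) (A B : set nat) :
  v0 S -> segment_bounds A B ->
  exists C D, [/\ segment_bounds C D, A `<=` C, D `<=` B
    & star_segment C D `&` S = set0].
Proof.
move=> vS AB.
pose state := (nat * (set nat * set nat))%type.
pose bd (x : state) := segment_bounds x.2.1 x.2.2.
(* The number in a state is a threshold: below it the bounds no longer change, and [k] is the free
   coordinate preserved by this stage. *)
pose R (x y : state) := [/\ bd y, x.2.1 `<=` y.2.1 /\ y.2.2 `<=` x.2.2,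
  y.2.1 `&` `I_x.1 `<=` x.2.1 /\ x.2.2 `&` `I_x.1 `<=` y.2.2,
  exists k, [/\ x.1 <= k, k < y.1, y.2.2 k & ~ y.2.1 k]
  & forall s X, segment ((s `&` `I_x.1) `|` (y.2.1 `\` `I_x.1))
                        ((s `&` `I_x.1) `|` (y.2.2 `\` `I_x.1)) X -> ~ S X].
have /choice[next nextP] : forall x, exists y, bd x -> R x y.
  move=> [n [A1 B1]]; have [bx|nbx] := pselect (segment_bounds A1 B1); last by exists (n, (A1, B1)).
  have [L HL] := subsets_seq n.
  have [A2 [B2 [bd2 sub2 froz2 avoid2]]] := v0_avoid_patches L vS (finite_II n) bx.
  have [k nk [Bk Ak]] : exists2 k, n <= k & (B2 `\` A2) k.
    apply: contrapT => nk; have [_ inf] := bd2; apply: inf; apply/finite_eventually.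
    by exists n => k nk' ?; apply: nk; exists k.
  exists (k.+1, (A2, B2)) => _; split=> //=; first by exists k.
  move=> s X sX; apply: (avoid2 (s `&` `I_n)); first by apply: HL => ? [].
  by rewrite -setIA setIid.
pose x j := iter j next (0, (A, B)).
have bdx j : bd (x j) by elim: j => [//|j /nextP[]].
have Rx j : R (x j) (x j.+1) by exact: nextP.
pose a j := (x j).2.1; pose b j := (x j).2.2.
have amono i j : i <= j -> a i `<=` a j.
  move/subnK <-; elim: (j - i) => [//|m IH]; apply: (subset_trans IH).
  by have [_ []] := Rx (m + i).
have bmono i j : i <= j -> b j `<=` b i.
  move/subnK <-; elim: (j - i) => [//|m IH]; apply: subset_trans IH.
  by have [_ []] := Rx (m + i).
have nmono i j : i <= j -> (x i).1 <= (x j).1.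
  move/subnK <-; elim: (j - i) => [//|m IH]; apply: (leq_trans IH).
  by have [_ _ _ [k [xk /ltnW ky _ _]] _] := Rx (m + i); exact: leq_trans xk ky.
have nge j : j <= (x j).1.
  elim: j => [//|j IH]; have [_ _ _ [k [xk ky _ _]] _] := Rx j.
  exact: leq_ltn_trans IH (leq_ltn_trans xk ky).
have afroz i j k : i <= j -> k < (x i).1 -> a j k -> a i k.
  move=> /subnK <- kn; elim: (j - i) => [//|m IH] ak; apply: IH.
  have [_ _ [H _] _ _] := Rx (m + i); apply: H; split=> //=.
  by apply: (leq_trans kn); apply: nmono; exact: leq_addl.
have bfroz i j k : i <= j -> k < (x i).1 -> b i k -> b j k.
  move=> /subnK <- kn bk; elim: (j - i) => [//|m IH].
  have [_ _ [_ H] _ _] := Rx (m + i); apply: H; split=> //=.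
  by apply: (leq_trans kn); apply: nmono; exact: leq_addl.
pose C : set nat := \bigcup_j a j; pose D : set nat := \bigcap_j b j.
exists C, D; split.
- split.
    move=> k [i _ aik] j _; have [abm _] := bdx (maxn i j).
    by apply: (bmono _ _ (leq_maxr i j)); apply: abm; exact: (amono _ _ (leq_maxl i j)).
  move=> /finite_eventually[N HN].
  have [_ _ _ [k [nk kn bk ak]] _] := Rx N.
  apply: (HN k); first exact: leq_trans (nge N) nk.
  split.
    move=> j _; have [jN|/ltnW Nj] := leqP j N.+1; first exact: (bmono _ _ jN).
    exact: bfroz Nj kn bk.
  move=> [j _ ajk]; apply: ak.
  have [jN|/ltnW Nj] := leqP j N.+1; first exact: (amono _ _ jN).
  exact: afroz Nj kn ajk.
- by move=> k Ak; exists 0.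
- by move=> k /(_ 0); apply.
apply/seteqP; split=> // X [[Xinf /almost_subsetE[N CX] /almost_subsetE[M XD]] SX].
(* The threshold at stage [j] is at least [j], so all deviations of [X] from the bounds form a
   pattern below it, handled with [s := X]. *)
pose j := maxn N M; have [_ _ _ _ avoid] := Rx j.
apply: (avoid X X) SX; split=> // k.
  move=> [[]//|[ak /negP]]; rewrite -leqNgt => nk; apply: CX; last by exists j.+1.
  exact: leq_trans (leq_trans (leq_maxl N M) (nge j)) nk.
move=> Xk; have [kn|nk] := ltnP k (x j).1; [by left|right]; split; last by apply/negP; rewrite -leqNgt.
apply: XD => //; exact: leq_trans (leq_trans (leq_maxr N M) (nge j)) nk.
Qed.

(** A Zorn-maximal *-disjoint family of *-segments missing [S] is maximal outright: any further
    *-segment would contain one missing [S]. *)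
Lemma v_partition_avoiding (S : set (set nat)) : v0 S ->
  exists P, v_partition P /\ forall I, P I -> I `&` S = set0.
Proof.
move=> vS.
pose good P := star_disjoint_family P /\ forall I, P I -> I `&` S = set0.
have [F Fgood Ftot|P [[[Pseg Pdisj] PS] Pmax]] := @Zorn_bigcup _ good.
  split; first split.
  - by move=> I [P /Fgood[[Pseg _] _] /Pseg].
  - move=> I J [P FP PI] [Q FQ QJ].
    have [PQ|QP] := Ftot P Q FP FQ.
      by have [[_ disj] _] := Fgood _ FQ; apply: disj => //; exact: PQ.
    by have [[_ disj] _] := Fgood _ FP; apply: disj => //; exact: QP.
  - by move=> I [P /Fgood[_ PS] /PS].
exists P; split=> //; split=> // Q [Qseg Qdisj] PQ.
apply/seteqP; split=> // J QJ; apply: contrapT => nPJ.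
have [A [B [AB JE]]] := Qseg _ QJ; subst J.
have [C [D [CD AC DB CDS]]] := v0_star_avoid vS AB.
have subAB : star_segment C D `<=` star_segment A B.
  by apply: star_segmentS; [move: AC|move: DB]; clear; move=> *; almost.
have disjP I : P I -> star_disjoint (star_segment C D) I.
  move=> PI; apply: (sub_countable (subset_card_le _)) (Qdisj _ _ QJ (PQ _ PI) _).
    by move=> X [/subAB].
  by move=> eqI; apply: nPJ; rewrite eqI.
have unc := uncountable_star_segment (segment_bounds_wide CD).
apply: (Pmax (P `|` [set star_segment C D])).
  split; first by move=> I; left.
  move=> /(_ (star_segment C D)) H; apply: unc.
  by have := disjP _ (H (or_intror erefl)); rewrite /star_disjoint setIid.
split; first split.
- by move=> I [/Pseg//|->]; exists C, D.
- move=> I J [PI|->] [PJ|->] IJ //; [exact: Pdisj|rewrite /star_disjoint setIC|];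
    exact: disjP.
- by move=> I [/PS//|->].
Qed.

(** One bound of the inclusion fails. Removing [A1 \ A] from [B], or adding [B \ B1] to [A], leaves
    a *-segment disjoint from the first member, and a member of [P] meeting it is the second. *)
Lemma v_partition_shatters (P : set (set (set nat))) (A B A1 B1 : set nat) :
  v_partition P -> wide A B -> P (star_segment A1 B1) ->
  wide (A `|` A1) (B `&` B1) -> ~ star_segment A B `<=` star_segment A1 B1 ->
  exists I1 I2, [/\ P I1, P I2, is_star_segment (I1 `&` star_segment A B),
    is_star_segment (I2 `&` star_segment A B)
    & I1 `&` star_segment A B <> I2 `&` star_segment A B].
Proof.
move=> vP [AB infAB] PI1 [w1 w1inf] nsub.
suff [A2 [B2 [X [PI2 w2 X2 XAB nX1]]]] : exists A2 B2 X, [/\ P (star_segment A2 B2),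
    wide (A `|` A2) (B `&` B2), star_segment A2 B2 X, star_segment A B X
    & ~ star_segment A1 B1 X].
  exists (star_segment A1 B1), (star_segment A2 B2); split=> //;
    rewrite 1?setIC ?star_segmentI; try exact: wide_is_star_segment.
  move=> /seteqP[_ /(_ X)]; rewrite -!star_segmentI => H.
  by have [//|_ ?] := H; exact: nX1.
have [A1A|A1A] := pselect (almost_subset A1 A); last first.
  have [|A2 [B2 [PI2 [w2 w2inf]]]] := @v_partition_meets P A (B `\` (A1 `\` A)) vP.
    by split; [clear w1inf; almost|apply: (infinite_almost_subset w1inf); clear w1inf; almost].
  exists A2, B2, ((B `\` (A1 `\` A)) `&` B2); split=> //.
  - by split; [|apply: (infinite_almost_subset w2inf)]; clear w2inf w1inf; almost.
  - split; try by clear w2inf w1inf; almost.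
    by apply: (infinite_almost_subset w2inf); clear; almost.
  - split; try by clear w2inf w1inf; almost.
    by apply: (infinite_almost_subset w2inf); clear; almost.
  - by move=> [_ sub _]; apply: A1A; clear - sub; almost.
have [BB1|BB1] := pselect (almost_subset B B1); first by case: nsub; exact: star_segmentS.
have [|A2 [B2 [PI2 [w2 w2inf]]]] := @v_partition_meets P (A `|` (B `\` B1)) B vP.
  by split; [clear w1inf; almost|apply: (infinite_almost_subset w1inf); clear w1inf; almost].
exists A2, B2, (B `&` B2); split=> //.
- by split; [|apply: (infinite_almost_subset w2inf)]; clear w2inf w1inf; almost.
- split; try by clear w2inf w1inf; almost.
  by apply: (infinite_almost_subset w2inf); clear; almost.
- split; try by clear w2inf w1inf; almost.
  by apply: (infinite_almost_subset w2inf); clear; almost.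
- by move=> [_ _ sub]; apply: BB1; clear - sub w2; almost.
Qed.

(** The map sending [X] to [A0 | e(X)] identifies the whole space with part of a segment; bounds are
    pulled back by preimage under [e]. *)
Lemma v0_preimage (S : set (set nat)) (A0 : set nat) (e : nat -> nat) :
  injective e -> (forall n, ~ A0 (e n)) -> v0 S ->
  v0 [set X | infinite_set X /\ S (A0 `|` e @` X)].
Proof.
move=> einj eA0 [_ vS]; split=> [X []//|C D [CD inf]].
have [|C1 [D1 [[CD1 inf1] /(segment_subset (conj CD1 inf1))[AC DB] CDS]]] :=
    vS (A0 `|` e @` C) (A0 `|` e @` D).
  split; first by move=> n [|[m /CD Dm <-]]; [left|right; exists m].
  apply: (sub_infinite_set _ (infinite_range einj inf)) => _ [m [Dm Cm] <-].
  by split; [right; exists m|move=> [/eA0//|[k Ck /einj km]]; apply: Cm; rewrite -km].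
have CC : C `<=` e @^-1` C1 by move=> n Cn; apply: AC; right; exists n.
have DD : e @^-1` D1 `<=` D by move=> n /DB[/eA0//|[m Dm /einj<-]].
exists (e @^-1` C1), (e @^-1` D1); split.
- split; first by move=> n; exact: CD1.
  move=> fin; apply: inf1; apply: (sub_finite_set _ (finite_image e fin)) => k [D1k C1k].
  have [A0k|[m _ mk]] := DB _ D1k; first by case: C1k; apply: AC; left.
  by exists m => //; split=> /=; rewrite mk.
- exact: segmentS.
apply/seteqP; split=> // X [[_ CX XD] [Xinf SX]].
suff : (segment C1 D1 `&` S) (A0 `|` e @` X) by rewrite CDS.
split=> //; split.
- by apply: (sub_infinite_set _ (infinite_range einj Xinf)) => k; right.
- move=> k C1k; have [A0k|[m _ mk]] := DB _ (CD1 _ C1k); first by left.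
  by right; exists m => //; apply: CX; rewrite /= mk.
- move=> k [A0k|[m /XD D1m <-]] //.
  by apply: CD1; apply: AC; left.
Qed.

Lemma shattering_of_v0_family (F : set (set (set nat))) :
  F `<=` v0 -> ~ v0 (\bigcup_(S in F) S) ->
  exists2 H, v_matrix H /\ shattering H & H #<= F.
Proof.
move=> Fv0 nv0.
have [A0 [B0 [[AB0 inf0] meet]]] : exists A0 B0, segment_bounds A0 B0 /\
    forall C D, segment_bounds C D -> A0 `<=` C -> D `<=` B0 ->
      exists2 S, F S & segment C D `&` S !=set0.
  apply: contrapT => H; apply: nv0; split; first by move=> X [S /Fv0[SS _] /SS].
  move=> A B AB; apply: contrapT => H'; apply: H; exists A, B; split=> // C D CD AC DB.
  apply: contrapT => H''; apply: H'; exists C, D; split=> //; first exact: segmentS.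
  apply/seteqP; split=> // X [CDX [S FS SX]]; apply: H''; exists S => //.
  by exists X.
have [e [einj eE]] := infinite_enum inf0.
pose pull S : set (set nat) := [set X | infinite_set X /\ S (A0 `|` e @` X)].
have eA0 n : ~ A0 (e n) by have [] := eE n.
have /choice[p pP] : forall S, exists P, v0 S -> v_partition P /\ forall I, P I -> I `&` pull S = set0.
  move=> S; have [vS|nvS] := pselect (v0 S); last by exists set0.
  have [P PP] := v_partition_avoiding (v0_preimage einj eA0 vS).
  by exists P.
exists (p @` F); last exact: card_image_le.
split; first by move=> _ [S /Fv0/pP[? _] <-].
move=> _ [A [B [AB ->]]]; have [sAB infAB] := AB.
have [E0 [E1 [E0E E1E E01 E0inf E1inf]]] := infinite_split infAB.
(* [E0] in the lower bound makes the preimage of [Y] infinite, while [E1] keeps infinitely many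
   coordinates free. *)
have [|||S FS [Y [[Yinf AY YB] SY]]] := meet (A0 `|` e @` (A `|` E0)) (A0 `|` e @` B).
- split.
    by move=> k [|[m Em <-]]; [left|right; exists m => //; case: Em => [/sAB//|/E0E[]]].
  apply: (sub_infinite_set _ (infinite_range einj E1inf)) => _ [m E1m <-]; split.
    by right; exists m => //; have [] := E1E m E1m.
  move=> [/eA0//|[k [Ak|E0k] /einj km]]; first by have [_] := E1E m E1m; rewrite -km.
  by have : (E0 `&` E1) m; [split=> //; rewrite -km|rewrite E01].
- by move=> k; left.
- by move=> k [/AB0//|[m _ <-]]; have [] := eE m.
have [vP avoid] := pP S (Fv0 _ FS).
have [A1 [B1 [PI w1]]] := v_partition_meets vP (segment_bounds_wide AB).
exists (p S); split; first by exists S.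
apply: (v_partition_shatters vP (segment_bounds_wide AB) PI w1) => sub.
have AE : A `|` E0 `<=` e @^-1` Y by move=> m Em; apply: AY; right; exists m.
have Xinf : infinite_set (e @^-1` Y).
  by apply: (sub_infinite_set _ E0inf) => m E0m; apply: AE; right.
suff : (star_segment A1 B1 `&` pull S) (e @^-1` Y) by rewrite avoid.
split.
  apply/sub/segment_star; split=> // m; first by move=> Am; apply: AE; left.
  by move=> /YB[/eA0//|[k Bk /einj <-]].
split=> //; suff -> : A0 `|` e @` (e @^-1` Y) = Y by [].
apply/seteqP; split=> k; first by move=> [A0k|[m Ym <-]] //; apply: AY; left.
by move=> Yk; have [A0k|[m _ mk]] := YB _ Yk; [left|right; exists m; rewrite //= mk].
Qed.

(** * Comparing the cardinals *)

Lemma v0_family_of_shattering (H : set (set (set (set nat)))) :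
  v_matrix H -> shattering H ->
  exists2 F, F `<=` v0 /\ ~ v0 (\bigcup_(S in F) S) & F #<= H.
Proof.
move=> Hpart Hshat.
have /choice[s sP] : forall P, exists S, v_partition P -> v0 S /\
    forall C D, segment_bounds C D ->
      (forall I, P I -> ~ star_segment C D `<=` I) -> S `&` segment C D !=set0.
  move=> P; have [vP|nvP] := pselect (v_partition P); last by exists set0.
  by have [S PS] := v_partition_transversal vP; exists S.
exists (s @` H); last exact: card_image_le.
split; first by move=> _ [P /Hpart/sP[? _] <-].
move=> [_ /(_ _ _ segment_bounds_full)[C [D [CD _ CDU]]]].
have [|P [HP [I1 [I2 [PI1 PI2 seg1 seg2 ne]]]]] := Hshat (star_segment C D).
  by exists C, D.
have [_ meet] := sP P (Hpart _ HP).
have [|X [sX CDX]] := meet _ _ CD; last first.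
  suff: (segment C D `&` \bigcup_(S in s @` H) S) X by rewrite CDU.
  by split=> //; exists (s P) => //; exists P.
have [[_ disj] _] := Hpart _ HP.
have unc J : is_star_segment J -> ~ countable J.
  move=> [A [B [AB ->]]]; exact/uncountable_star_segment/segment_bounds_wide.
move=> I PI sub.
(* A member covering [<C,D>*] has uncountable intersection with each [J] that meets it in a
   *-segment, so [I1] and [I2] would coincide. *)
have eqI J : P J -> is_star_segment (J `&` star_segment C D) -> J = I.
  move=> PJ seg; apply: contrapT => JI; apply: (unc _ seg).
  apply: sub_countable (disj _ _ PJ PI JI).
  by apply: subset_card_le => X [JX /sub].
by apply: ne; rewrite (eqI _ PI1 seg1) (eqI _ PI2 seg2).
Qed.

(* A maximal family of choice functions on C that differ everywhere exhausts
   some member X of C, and evaluating them at Y embeds X into Y. *)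
Lemma exists_card_le_min (T : Type) (C : set (set T)) : C !=set0 ->
  exists2 X, C X & forall Y, C Y -> X #<= Y.
Proof.
move=> [X0 CX0].
pose good (Phi : set (set T -> T)) := (forall g X, Phi g -> C X -> X (g X)) /\
  forall g g' X, Phi g -> Phi g' -> C X -> g X = g' X -> g = g'.
have [G Ggood Gtot|Phi [[Phi_in Phi_inj] Phi_max]] := @Zorn_bigcup _ good.
  split; first by move=> g X [Phi /Ggood[H _] Phig]; exact: H.
  move=> g g' X [P GP Pg] [Q GQ Qg'] CX.
  have [PQ|QP] := Gtot P Q GP GQ.
    by have [_ H] := Ggood _ GQ; apply: H CX => //; exact: PQ.
  by have [_ H] := Ggood _ GP; apply: H CX => //; exact: QP.
have [X [CX XPhi]] : exists X, C X /\ X `<=` (@^~ X) @` Phi.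
  apply: contrapT => nX.
  have miss X : C X -> exists2 x, X x & forall g, Phi g -> g X <> x.
    move=> CX; apply: contrapT => nx; apply: nX; exists X; split=> // x Xx.
    by apply: contrapT => ng; apply: nx; exists x => // g Phig gx; apply: ng; exists g.
  have [x0 _ _] := miss _ CX0.
  have /choice[g0 g0P] : forall X, exists x, C X -> X x /\ forall g, Phi g -> g X <> x.
    move=> X; have [CX|nCX] := pselect (C X); last by exists x0.
    by have [x] := miss X CX; exists x.
  apply: (Phi_max (Phi `|` [set g0])).
    split; first by move=> g; left.
    move=> /(_ g0 (or_intror erefl)) Phig0.
    by have [_ /(_ _ Phig0)] := g0P _ CX0.
  split; first by move=> g X [Phig|->] CX; [exact: (Phi_in g X)|have [] := g0P X CX].
  move=> g g' X [Phig|->] [Phig'|->] CX // eqX; first exact: (Phi_inj g g' X).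
    by have [_ /(_ _ Phig)] := g0P X CX.
  by have [_ /(_ _ Phig')] := g0P X CX; rewrite eqX.
exists X => // Y CY.
apply: card_le_trans (subset_card_le XPhi) _.
apply: card_le_trans (card_image_le _ _) _.
have inj : {in Phi &, injective (@^~ Y)}.
  by move=> g g'; rewrite !inE => Phig Phig'; exact: (Phi_inj g g' Y).
have := inj_card_eq inj; rewrite card_eq_le => /andP[_ le].
apply: card_le_trans le _; apply: subset_card_le => _ [g Phig <-].
exact: (Phi_in g Y).
Qed.

(** Decide one free coordinate of the segment against [X]. *)
Lemma v0_set1 (X : set nat) : infinite_set X -> v0 [set X].
Proof.
move=> Xinf; split=> [_ -> //|A B [AB inf]].
have [n [Bn An]] := infinite_setN0 inf.
have [Xn|nXn] := pselect (X n).
  exists A, (B `\` [set n]); split.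
  - split; first by move=> m Am; split; [exact: AB|move=> /= mn; apply: An; rewrite -mn].
    have fin := finite_set1 n; apply: (infinite_almost_subset inf).
    by move: [set n] fin => N *; almost.
  - by apply: segmentS => // m [].
  - by apply/seteqP; split=> // Y [[_ _ YB] YX]; have [|_] := YB n; rewrite ?YX //; apply.
exists (A `|` [set n]), B; split.
- split; first by move=> m [/AB|->].
  have fin := finite_set1 n; apply: (infinite_almost_subset inf).
  by move: [set n] fin => N *; almost.
- by apply: segmentS => // m; left.
- by apply/seteqP; split=> // Y [[_ YA _] YX]; apply: nXn; rewrite -YX; apply: YA; right.
Qed.

Lemma v0_family_exists : exists F, F `<=` v0 /\ ~ v0 (\bigcup_(S in F) S).
Proof.
exists (set1 @` infinite_subsets); split; first by move=> _ [X Xinf <-]; exact: v0_set1.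
move=> [_ /(_ _ _ segment_bounds_full)[C [D [[CD inf] _ CDU]]]].
have Dinf : infinite_set D by apply: (sub_infinite_set _ inf) => n [].
suff : (segment C D `&` \bigcup_(S in set1 @` infinite_subsets) S) D by rewrite CDU.
by split; [split|exists [set D] => //; exists D].
Qed.

Theorem theorem15 :
  exists (U : Type) (K : set U), is_kappa_v K /\ is_add_v0 K.
Proof.
have [K [Kv0 nK] Kmin] := exists_card_le_min v0_family_exists.
exists (set (set nat)), K; split; last by split; [exists K|exact: Kmin].
have Kle H : v_matrix H -> shattering H -> K #<= H.
  move=> Hm Hs; have [F FP FH] := v0_family_of_shattering Hm Hs.
  exact: card_le_trans (Kmin F FP) FH.
split; last by move=> H [Hm Hs]; exact: Kle.
have [H [Hm Hs] HK] := shattering_of_v0_family Kv0 nK.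
by exists H => //; rewrite card_eq_le HK Kle.
Qed.
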